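(* Let $n\ge 1$, $\alpha,\beta>-1$ and $\sigma:=\alpha+\beta+1$. The dual polynomials $dG^n_j(t;\alpha,\beta)$ $(0\le j\le n)$ are represented in the Jacobi polynomial basis as follows: $$dG^n_j(t;\alpha,\beta)=\sum_{i=0}^{n}\frac{1}{h^{(\alpha,\beta)}_i}\,c^{(\alpha,\beta)}_{ji}\,P^{(\alpha,\beta)}_i(t)\qquad(j=0,1,\ldots,n),$$ where, for $i=0,1,\ldots,n$, $$c^{(\alpha,\beta)}_{0i}:=\frac{1}{i!}\left((\alpha+1)_i+(-1)^i(\beta+1)_i\right),\qquad c^{(\alpha,\beta)}_{ji}:=\omega_j\,\frac{i+\sigma}{2}\,P^{(\alpha+1,\beta+1)}_{i-1}(\tau_j)\quad(1\le j\le n).$$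
   Context: $\Pi_k$ is the space of real univariate polynomials of degree at most $k$. $P_k$ is the $k$th Legendre polynomial (orthogonal on $[-1,1]$ with weight $1$, normalized by $P_k(1)=1$). Fix $n\ge1$; $-1<\tau_1<\cdots<\tau_n<1$ are the zeros of $P_n$, and $\omega_i:=\dfrac{2}{nP_{n-1}(\tau_i)P_n'(\tau_i)}$ $(1\le i\le n)$ are the Gauss--Legendre weights. Polynomials $G^n_i$: $G^n_0(t)\equiv\frac12$ and, for $1\le i\le n$, $$G^n_i(t):=\frac{nP_{n-1}(\tau_i)}{2}\int_{-1}^{t}\frac{P_n(x)}{x-\tau_i}\,\mathrm{d}x-\frac12 .$$ The polynomials $G^n_0,\ldots,G^n_n$ form a basis of $\Pi_n$. Jacobi inner product: $\langle f,g\rangle_{\alpha,\beta}:=\int_{-1}^{1}(1-x)^\alpha(1+x)^\beta f(x)g(x)\,\mathrm{d}x$ $(\alpha,\beta>-1)$. The dual polynomials $dG^n_j(\cdot;\alpha,\beta)\in\Pi_n$ $(0\le j\le n)$ are defined by the conditions $\langle G^n_i,dG^n_j(\cdot;\alpha,\beta)\rangle_{\alpha,\beta}=\delta_{ij}$ for $0\le i,j\le n$. $P^{(\alpha,\beta)}_k$ is the Jacobi polynomial of degree $k$, orthogonal with respect to $\langle\cdot,\cdot\rangle_{\alpha,\beta}$ and normalized by $P^{(\alpha,\beta)}_k(1)=(\alpha+1)_k/k!$, with the convention $P^{(\alpha,\beta)}_{-1}\equiv0$. Its squared norm is $$h^{(\alpha,\beta)}_k:=\langle P^{(\alpha,\beta)}_k,P^{(\alpha,\beta)}_k\rangle_{\alpha,\beta}=2^\sigma\frac{\Gamma(k+\alpha+1)\Gamma(k+\beta+1)}{k!\,(2k+\sigma)\,\Gamma(k+\sigma)}$$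 (for $k=0$, $\sigma=0$ the product $\sigma\Gamma(\sigma)$ is read as $\Gamma(\sigma+1)=1$). $(z)_0:=1$, $(z)_i:=z(z+1)\cdots(z+i-1)$ is the Pochhammer symbol. *)

(* Defs.v *)
From HB Require Import structures.
From mathcomp Require Import all_boot all_order all_algebra.
From mathcomp Require Import all_classical all_reals all_analysis.
Set Implicit Arguments.
Unset Strict Implicit.
Unset Printing Implicit Defensive.
Import Order.TTheory GRing.Theory Num.Theory.
Import numFieldNormedType.Exports.
Local Open Scope classical_set_scope.
Local Open Scope ring_scope.

(* Oriented integral: the sign convention makes it meaningful for b < a. *)
Definition oriented_integral (R : realType) (a b : R) (f : R -> R) : R :=
  if a <= b then \int[@lebesgue_measure R]_(x in `[a, b]) f x
  else - \int[@lebesgue_measure R]_(x in `[b, a]) f x.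

Definition pochhammer (R : realType) (z : R) (i : nat) : R :=
  \prod_(m < i) (z + m%:R).

(* The integrand is unbounded at an endpoint when a or b is negative; the
   Lebesgue integral covers this case, and the junk values 0 `^ a, 0 `^ b at
   the two endpoints do not matter. *)
Definition jacobi_dot (R : realType) (a b : R) (f g : R -> R) : R :=
  \int[@lebesgue_measure R]_(x in `[-1, 1])
     ((1 - x) `^ a * (1 + x) `^ b * f x * g x).

(* The polynomials of degree exactly k have size k.+1, so each of the next two
   predicates determines the family P uniquely. *)
Definition is_legendre (R : realType) (P : nat -> {poly R}) : Prop :=
  [/\ forall k, size (P k) = k.+1,
      forall k l, k <> l ->
        \int[@lebesgue_measure R]_(x in `[-1, 1]) ((P k).[x] * (P l).[x]) = 0
    & forall k, (P k).[1] = 1].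

Definition is_jacobi (R : realType) (a b : R) (P : nat -> {poly R}) : Prop :=
  [/\ forall k, size (P k) = k.+1,
      forall k l, k <> l -> jacobi_dot a b (horner (P k)) (horner (P l)) = 0
    & forall k, (P k).[1] = pochhammer (a + 1) k / k`!%:R].

Definition jacobi_sqnorm (R : realType) (a b : R) (P : nat -> {poly R})
    (k : nat) : R :=
  jacobi_dot a b (horner (P k)) (horner (P k)).

(* The polynomial of index k - 1, with the convention P_(-1) = 0. *)
Definition pred_index (R : realType) (P : nat -> {poly R}) (k : nat) :
    {poly R} :=
  if k is m.+1 then P m else 0.

(* Only the values tau 1, ..., tau n are meaningful. *)
Definition ordered_zeros (R : realType) (p : {poly R}) (n : nat)
    (tau : nat -> R) : Prop :=
  [/\ forall i, (1 <= i <= n)%N -> -1 < tau i < 1,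
      forall i j, (1 <= i)%N -> (i < j)%N -> (j <= n)%N -> tau i < tau j
    & forall x, root p x <-> exists2 i, (1 <= i <= n)%N & x = tau i].

Definition gauss_weight (R : realType) (P : nat -> {poly R}) (n : nat)
    (tau : nat -> R) (i : nat) : R :=
  2 / (n%:R * (P n.-1).[tau i] * (P n)^`().[tau i]).

(* In the integrand, division by zero gives 0 at the removable singularity
   x = tau i, which is a single point and does not affect the integral. *)
Definition Gfun (R : realType) (P : nat -> {poly R}) (n : nat)
    (tau : nat -> R) (i : nat) (t : R) : R :=
  if i is 0 then 1 / 2
  else n%:R * (P n.-1).[tau i] / 2
         * oriented_integral (-1) t (fun x => (P n).[x] / (x - tau i))
       - 1 / 2.

Definition is_dual_basis (R : realType) (a b : R) (n : nat)
    (G : nat -> R -> R) (dG : nat -> {poly R}) : Prop :=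
  (forall j, (j <= n)%N -> (size (dG j) <= n.+1)%N) /\
  (forall i j, (i <= n)%N -> (j <= n)%N ->
     jacobi_dot a b (G i) (horner (dG j)) = (i == j)%:R).

Definition dual_coef (R : realType) (a b : R) (P : nat -> {poly R})
    (J : R -> R -> nat -> {poly R}) (n : nat) (tau : nat -> R)
    (j i : nat) : R :=
  let sigma := a + b + 1 in
  if j is 0 then
    (i`!%:R)^-1 * (pochhammer (a + 1) i + (-1) ^+ i * pochhammer (b + 1) i)
  else
    gauss_weight P n tau j * ((i%:R + sigma) / 2)
      * (pred_index (J (a + 1) (b + 1)) i).[tau j].

(* Main.v *)
(* In terms of the basis G, a polynomial p of degree at most n reads
     p = (p(1) + p(-1)) G_0 + sum_j omega_j p'(tau_j) G_j :
   the derivatives agree by Lagrange interpolation of p' at the Gauss nodes, and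
   the constant is fixed by G_j(1) = - G_j(-1) = 1/2, i.e. by
   n P_(n-1)(tau_j) int P_n(x) / (x - tau_j) dx = 2.  Duality turns these
   coefficients, for p a Jacobi polynomial P_i, into the inner products of P_i
   with dG_j.  It remains to know P_i(1), P_i(-1) and P_i', which come from the
   differential equation of P_i: the operator jacobi_op is symmetric, hence P_i is
   an eigenvector, and evaluation of the equation at 1 and -1 gives the
   normalizations.  The weight being singular at the endpoints, symmetry relies on
   the fundamental theorem of calculus for an integrand that is only continuous on
   the open interval. *)
Require Import Defs.
From HB Require Import structures.
From mathcomp Require Import all_boot all_order all_algebra.
From mathcomp Require Import all_classical all_reals all_analysis.
From mathcomp Require Import measurable_realfun ring lra.
Set Implicit Arguments.
Unset Strict Implicit.
Unset Printing Implicit Defensive.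
Import Order.TTheory GRing.Theory Num.Theory.
Import numFieldNormedType.Exports.
Local Open Scope classical_set_scope.
Local Open Scope ring_scope.

(** * Fundamental theorem of calculus with data on the open interval *)

Lemma FTC2_oo (R : realType) (f F : R -> R) (a b : R) : a < b ->
  (@lebesgue_measure R).-integrable `[a, b] (EFin \o f) ->
  {in `]a, b[, continuous f} ->
  {in `]a, b[, forall x : R, is_derive x 1 F (f x)} ->
  {within `[a, b], continuous F} ->
  \int[@lebesgue_measure R]_(x in `[a, b]) f x = F b - F a.
Proof.
move=> ab intf cf dF cF.
(* [F - G] has zero derivative inside and is continuous up to the endpoints, continuity of [G] there
   coming from integrability alone; the mean value theorem then equates its two end values. *)
pose G x := \int[@lebesgue_measure R]_(t in `[a, x]) f t.
have dFG x : x \in `]a, b[ -> is_derive x 1 (F - G) 0.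
  move=> xab; have := xab; rewrite in_itv/= => /andP[ax xb].
  have [dG G'] := continuous_FTC1_closed xb intf ax (cf _ xab).
  have dGx : is_derive x 1 G (f x).
    by apply: DeriveDef; [exact: dG|rewrite -G' derive1E].
  have dFx := dF _ xab.
  by apply: is_derive_eq; rewrite subrr.
have [] := MVT ab dFG.
  move=> x; apply: cvgB; first exact: cF.
  exact: (parameterized_integral_continuous (ltW ab) intf).
move=> c _; rewrite mul0r !fctE => /eqP.
by rewrite /G set_itv1 Rintegral_set1 subr0 addrAC subr_eq0 => /eqP <-.
Qed.

Lemma integrable_itvoo_cc (R : realType) (f : R -> R) (a b : R) :
  (@lebesgue_measure R).-integrable `]a, b[ (EFin \o f) ->
  (@lebesgue_measure R).-integrable `[a, b] (EFin \o f).
Proof.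
move=> /integrableP[mf fy].
have mf2 : measurable_fun `]a, b] f.
  by apply/measurable_fun_itv_bndo_bndcP/measurable_EFinP.
have mf3 : measurable_fun `[a, b] f by exact/measurable_fun_itv_obnd_cbndP.
apply/integrableP; split; first exact/measurable_EFinP.
rewrite -integral_itv_obnd_cbnd; last first.
  by apply: measurableT_comp => //; exact/measurable_EFinP.
rewrite -integral_itv_bndo_bndc//.
exact: measurableT_comp.
Qed.

(** Exhaust the open interval by compact ones. On each, the integral is an increment of the
    nondecreasing [F], hence at most [F b - F a]; monotone convergence passes the bound to the
    union. This yields integrability of singular powers. *)
Lemma ge0_FTC2_integrable (R : realType) (f F : R -> R) (a b : R) : a < b ->
  {in `]a, b[, forall x : R, 0 <= f x} ->
  {in `]a, b[, continuous f} ->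
  {in `]a, b[, forall x : R, is_derive x 1 F (f x)} ->
  {within `[a, b], continuous F} ->
  (@lebesgue_measure R).-integrable `[a, b] (EFin \o f).
Proof.
move=> ab f0 cf dF cF; apply: integrable_itvoo_cc.
have mf : measurable_fun `]a, b[ f.
  apply: open_continuous_measurable_fun; first exact: interval_open.
  by move=> x; rewrite inE => xab; exact: (cf x xab).
pose S (k : nat) := `[a + k.+1%:R^-1, b - k.+1%:R^-1]%classic : set R.
have Sab k : S k `<=` `]a, b[.
  by apply: subset_itv; rewrite bnd_simp ?ltrDl ?ltrBlDr ?ltrDl invr_gt0.
have US : \bigcup_k S k = `]a, b[%classic.
  apply/seteqP; split => [x [k _]|x]; first exact: Sab.
  rewrite /= in_itv/= => /andP[ax xb].
  have xa0 : 0 < x - a by rewrite subr_gt0.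
  have bx0 : 0 < b - x by rewrite subr_gt0.
  near \oo => k.
  exists k => //; rewrite /S/= in_itv/=; apply/andP; split.
    by rewrite -lerBrDl ltW//; near: k; exact: (near_infty_natSinv_lt (PosNum xa0)).
  by rewrite lerBrDl -lerBrDr ltW//; near: k; exact: (near_infty_natSinv_lt (PosNum bx0)).
apply/integrableP; split; first exact/measurable_EFinP.
have -> : (\int[@lebesgue_measure R]_(x in `]a, b[) `|(EFin \o f) x|
         = \int[@lebesgue_measure R]_(x in `]a, b[) (EFin \o f) x)%E.
  apply: eq_integral => x; rewrite inE => xab /=; rewrite ger0_norm//.
  exact: f0.
rewrite -US.
have ndS : {homo S : n m / (n <= m)%N >-> (n <= m)%O}.
  move=> n m nm; apply/subsetPset; apply: subset_itv; rewrite bnd_simp.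
    by rewrite lerD2l lef_pV2 ?posrE// ler_nat.
  by rewrite lerD2l lerN2 lef_pV2 ?posrE// ler_nat.
have Fint k : (\int[@lebesgue_measure R]_(x in S k) (EFin \o f) x
               <= (F b - F a)%:E)%E.
  have Fnd x y : a <= x -> x <= y -> y <= b -> F x <= F y.
    move=> ax; rewrite le_eqVlt => /predU1P[->//|xy yb].
    have xyab : `[x, y] `<=` `[a, b] by apply: subset_itv; rewrite bnd_simp.
    have xyabo z : z \in `]x, y[ -> z \in `]a, b[.
      by rewrite !in_itv/= => /andP[xz zy]; rewrite (le_lt_trans ax)//= (lt_le_trans zy).
    have [] := @MVT R F f x y xy.
    - by move=> z /xyabo; exact: dF.
    - exact: continuous_subspaceW cF.
    - move=> c cxy FE; rewrite -subr_ge0 FE mulr_ge0// ?f0 ?subr_ge0 ?ltW//.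
      exact: xyabo.
  have := Sab k; have : 0 < k.+1%:R^-1 :> R by rewrite invr_gt0.
  rewrite /S; move: k.+1%:R^-1 => e e0 Se.
  (* For small k, [S k] may be empty or a single point; its integral is then 0. *)
  have [le|lt] := leP (b - e) (a + e).
    suff -> : (\int[@lebesgue_measure R]_(x in `[(a + e)%R, (b - e)%R]) (EFin \o f) x = 0)%E.
      by rewrite lee_fin subr_ge0 Fnd// ltW.
    move: le; rewrite le_eqVlt => /predU1P[ee|lt].
      by rewrite ee set_itv1 integral_set1.
    by rewrite set_itv_ge ?integral_set0// bnd_simp -ltNge.
  have ifS : (@lebesgue_measure R).-integrable (`[a + e, b - e]) (EFin \o f).
    apply: continuous_compact_integrable; first exact: segment_compact.
    apply: continuous_in_subspaceT => x; rewrite inE => xS.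
    exact: (cf x (Se _ xS)).
  have sub : {subset `](a + e)%R, (b - e)%R[ <= `]a, b[}.
    by move=> z; rewrite !in_itv/= => /andP[xz zy]; apply/andP; split; lra.
  have := @FTC2_oo R f F _ _ lt ifS.
  move=> /(_ (fun x xS => cf x (sub x xS)) (fun x xS => dF x (sub x xS))).
  have cFS : {within `[a + e, b - e], continuous F}.
    apply: continuous_subspaceW cF; apply: subset_itv; rewrite bnd_simp; lra.
  move=> /(_ cFS) FTC.
  rewrite -(fineK (integrable_fin_num _ ifS))//=.
  have -> : fine (\int[@lebesgue_measure R]_(x in `[(a + e)%R, (b - e)%R]) (f x)%:E)%E =
      F (b - e) - F (a + e) by exact: FTC.
  by rewrite lee_fin lerB// Fnd//; lra.
have cv : (\int[@lebesgue_measure R]_(x in S k) (EFin \o f) x @[k --> \oo] -->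
           \int[@lebesgue_measure R]_(x in \bigcup_k S k) (EFin \o f) x)%E.
  apply: ge0_nondecreasing_set_cvg_integral => //.
  - by move=> k; exact: measurable_itv.
  - move=> k; apply/measurable_EFinP; apply: (measurable_funS _ (Sab k) mf).
    exact: measurable_itv.
  - by move=> k x xS; rewrite lee_fin f0//; exact: (Sab k).
apply: (@le_lt_trans _ _ (F b - F a)%:E); last exact: ltry.
rewrite -(cvg_lim _ cv)//; apply: lime_le; first by apply: cvgP cv.
by apply: nearW.
Unshelve. all: by end_near. Qed.

Lemma integrable_itv_cc_setU (R : realType) (f : R -> R) (a c b : R) :
  a <= c -> c <= b ->
  (@lebesgue_measure R).-integrable `[a, c] (EFin \o f) ->
  (@lebesgue_measure R).-integrable `[c, b] (EFin \o f) ->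
  (@lebesgue_measure R).-integrable `[a, b] (EFin \o f).
Proof.
move=> ac cb iac icb.
have {icb} : (@lebesgue_measure R).-integrable `]c, b] (EFin \o f).
  by apply: integrableS icb => //; exact: subset_itv_oc_cc.
move=> /integrableP[/measurable_EFinP mcb ycb].
have /integrableP[/measurable_EFinP mac yac] := iac.
have U : `[a, b]%classic = `[a, c]%classic `|` `]c, b]%classic :> set R.
  by rewrite -itv_bndbnd_setU.
have mab : measurable_fun (`[a, c]%classic `|` `]c, b]%classic) f.
  by apply/measurable_funU.
apply/integrableP; rewrite U; split; first exact/measurable_EFinP.
rewrite ge0_integral_setU//.
- exact: lte_add_pinfty.
- by apply: measurableT_comp => //; exact/measurable_EFinP.
- apply/disj_setPS => x; rewrite /= !in_itv/= => -[/andP[_ xc] /andP[cx _]].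
  by move: cx; rewrite ltNge xc.
Qed.

(** * Powers of 1 + x and 1 - x, integrability of the Jacobi weight, null sets of roots *)

Lemma cvg_onepD_powR0 (R : realType) (s : R) : 0 < s ->
  (1 + x) `^ s @[x --> (-1)^'+] --> (0 : R).
Proof.
move=> s0; apply: cvg_comp (powR_cvg0 s0).
move=> P [d d0 dP]; exists d => // x /= xd x1; apply: dP => /=; last by lra.
by move: xd; rewrite (_ : -1 - x = 0 - (1 + x))//; lra.
Qed.

Lemma cvg_onemD_powR0 (R : realType) (s : R) : 0 < s ->
  (1 - x) `^ s @[x --> 1^'-] --> (0 : R).
Proof.
move=> s0; apply: cvg_comp (powR_cvg0 s0).
move=> P [d d0 dP]; exists d => // x /= xd x1; apply: dP => /=; last by lra.
by move: xd; rewrite (_ : 0 - (1 - x) = - (1 - x))// ?normrN//; lra.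
Qed.

Lemma is_derive_onepD_powR (R : realType) (s x : R) : -1 < x ->
  is_derive x 1 (fun x : R => (1 + x) `^ s) (s * (1 + x) `^ (s - 1)).
Proof.
move=> x1.
have h : is_derive (1 + x) 1 (fun y : R => y `^ s) (s * (1 + x) `^ (s - 1)).
  by apply: is_derive1_powR; lra.
have h2 : is_derive x 1 (fun x : R => 1 + x) 1.
  by have := is_deriveD (is_derive_cst (1 : R) x 1) (is_derive_id x (1 : R)); rewrite add0r.
by have := is_derive1_comp h h2; rewrite mulr1.
Qed.

Lemma is_derive_onemD_powR (R : realType) (s x : R) : x < 1 ->
  is_derive x 1 (fun x : R => (1 - x) `^ s) (- (s * (1 - x) `^ (s - 1))).
Proof.
move=> x1.
have h : is_derive (1 - x) 1 (fun y : R => y `^ s) (s * (1 - x) `^ (s - 1)).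
  by apply: is_derive1_powR; lra.
have h2 : is_derive x 1 (fun x : R => 1 - x) (- 1).
  by have := is_deriveB (is_derive_cst (1 : R) x 1) (is_derive_id x (1 : R)); rewrite sub0r.
by have := @is_derive1_comp R (fun y => y `^ s) (fun x => 1 - x) x _ _ h h2; rewrite mulrN1.
Qed.

Lemma continuous_onepD_powR (R : realType) (s x : R) : -1 < x ->
  {for x, continuous (fun x : R => (1 + x) `^ s)}.
Proof.
move=> /(is_derive_onepD_powR s) h.
by apply: differentiable_continuous; apply/derivable1_diffP; exact: ex_derive.
Qed.

Lemma continuous_onemD_powR (R : realType) (s x : R) : x < 1 ->
  {for x, continuous (fun x : R => (1 - x) `^ s)}.
Proof.
move=> /(is_derive_onemD_powR s) h.
by apply: differentiable_continuous; apply/derivable1_diffP; exact: ex_derive.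
Qed.

(** As b + 1 > 0, the primitive (1 + x)^(b+1) / (b + 1) is continuous at -1 even when the integrand
    blows up there. *)
Lemma integrable_onepD_powR (R : realType) (b : R) : -1 < b ->
  (@lebesgue_measure R).-integrable `[-1, 0] (EFin \o (fun x => (1 + x) `^ b)).
Proof.
move=> b1.
have b0 : 0 < b + 1 by lra.
have bn0 : b + 1 != 0 by rewrite gt_eqF.
apply: (@ge0_FTC2_integrable R _ (fun x => (b + 1)^-1 * (1 + x) `^ (b + 1))).
- by lra.
- by move=> x _; exact: powR_ge0.
- move=> x; rewrite in_itv/= => /andP[x1 _]; exact: continuous_onepD_powR.
- move=> x; rewrite in_itv/= => /andP[x1 _].
  have h := is_derive_onepD_powR (b + 1) x1.
  have := is_deriveZ (b + 1)^-1 h.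
  by rewrite /GRing.scale/= mulrA mulVf// mul1r addrK.
- apply/continuous_within_itvP; first by lra.
  split.
  + move=> x; rewrite in_itv/= => /andP[x1 _].
    by apply: cvgM; [exact: cvg_cst|exact: continuous_onepD_powR].
  + rewrite subrr powR0// mulr0 -[X in _ --> X](mulr0 (b + 1)^-1).
    by apply: cvgM; [exact: cvg_cst|exact: cvg_onepD_powR0].
  + apply: cvg_at_left_filter.
    apply: cvgM; [exact: cvg_cst|]; apply: continuous_onepD_powR; lra.
Qed.

Lemma integrable_onemD_powR (R : realType) (b : R) : -1 < b ->
  (@lebesgue_measure R).-integrable `[0, 1] (EFin \o (fun x => (1 - x) `^ b)).
Proof.
move=> b1.
have b0 : 0 < b + 1 by lra.
have bn0 : b + 1 != 0 by rewrite gt_eqF.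
apply: (@ge0_FTC2_integrable R _ (fun x => - (b + 1)^-1 * (1 - x) `^ (b + 1))).
- by lra.
- by move=> x _; exact: powR_ge0.
- move=> x; rewrite in_itv/= => /andP[_ x1]; exact: continuous_onemD_powR.
- move=> x; rewrite in_itv/= => /andP[_ x1].
  have h := is_derive_onemD_powR (b + 1) x1.
  have := is_deriveZ (- (b + 1)^-1) h.
  by rewrite /GRing.scale/= mulrNN mulrA mulVf// mul1r addrK.
- apply/continuous_within_itvP; first by lra.
  split.
  + move=> x; rewrite in_itv/= => /andP[_ x1].
    by apply: cvgM; [exact: cvg_cst|exact: continuous_onemD_powR].
  + apply: cvg_at_right_filter.
    apply: cvgM; [exact: cvg_cst|]; apply: continuous_onemD_powR; lra.
  + rewrite subrr powR0// mulr0 -[X in _ --> X](mulr0 (- (b + 1)^-1)).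
    by apply: cvgM; [exact: cvg_cst|exact: cvg_onemD_powR0].
Qed.

Definition jacobi_weight (R : realType) (a b x : R) : R :=
  (1 - x) `^ a * (1 + x) `^ b.

(** Split at 0: on each half only one power can be singular, and the other one times [p] is
    continuous on a compact interval, hence bounded. *)
Lemma integrable_jacobi_weight (R : realType) (a b : R) (p : {poly R}) :
  -1 < a -> -1 < b ->
  (@lebesgue_measure R).-integrable `[-1, 1]
    (EFin \o (fun x => jacobi_weight a b x * p.[x])).
Proof.
have aux (h g : R -> R) (l r : R) :
    (@lebesgue_measure R).-integrable `[l, r] (EFin \o g) ->
    {within `[l, r], continuous h} ->
    (@lebesgue_measure R).-integrable `[l, r] (EFin \o (fun x => h x * g x)).
  move=> ig ch.
  rewrite (_ : _ \o _ = (EFin \o h) \* (EFin \o g))%E; last first.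
    by apply/funext => x /=; rewrite EFinM.
  apply: integrableMr => //.
    by apply: subspace_continuous_measurable_fun.
  have /compact_bounded := continuous_compact ch (@segment_compact _ l r).
  by move=> [M [Mr hM]]; exists M; split => // y My z zlr; apply: hM => //; exists z.
move=> a1 b1; apply: (@integrable_itv_cc_setU _ _ _ 0); rewrite ?lerN10//.
- rewrite (_ : (fun x => _) = fun x => ((1 - x) `^ a * p.[x]) * (1 + x) `^ b).
    apply: aux; first exact: integrable_onepD_powR.
    apply: continuous_in_subspaceT => x; rewrite inE/= in_itv/= => /andP[_ x0].
    apply: cvgM; last exact: continuous_horner.
    by apply: continuous_onemD_powR; lra.
  by apply/funext => x; rewrite /jacobi_weight; ring.
- rewrite (_ : (fun x => _) = fun x => ((1 + x) `^ b * p.[x]) * (1 - x) `^ a).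
    apply: aux; first exact: integrable_onemD_powR.
    apply: continuous_in_subspaceT => x; rewrite inE/= in_itv/= => /andP[x0 _].
    apply: cvgM; last exact: continuous_horner.
    by apply: continuous_onepD_powR; lra.
  by apply/funext => x; rewrite /jacobi_weight; ring.
Qed.

(** Induction on the size: each factor X - r adds one point to the root set. *)
Lemma negligible_root (R : realType) (p : {poly R}) : p != 0 ->
  (@lebesgue_measure R).-negligible [set x | root p x].
Proof.
have [n le_pn] := ubnP (size p); elim: n => // n IHn in p le_pn *.
move=> p0; have [[r pr]|nr] := pselect (exists r, root p r); last first.
  apply: (negligibleS _ (@negligible_set0 _ _ _ _)) => x /= px.
  by apply: nr; exists x.
have /factor_theorem[q pE] := pr.
have q0 : q != 0 by apply: contraNneq p0 => q0; rewrite pE q0 mul0r.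
have sub : [set x | root p x] `<=` [set x | root q x] `|` [set r].
  move=> x /=; rewrite pE rootM root_XsubC => /orP[qx|/eqP ->]; first by left.
  by right.
apply: (@negligibleS _ _ _ (@lebesgue_measure R) _ _ sub); apply: negligibleU.
  apply: IHn => //.
  by move: le_pn; rewrite pE size_Mmonic ?monicXsubC// size_XsubC addn2.
exists [set r]; split => //.
exact: lebesgue_measure_set1.
Qed.

(** * The Jacobi integral as a functional on polynomials *)

Lemma powR_addr1 (R : realType) (x s : R) : 0 <= x -> -1 < s ->
  x `^ (s + 1) = x * x `^ s.
Proof.
(* A positive exponent on the left makes both sides vanish at x = 0. *)
move=> x0 s1; have s0 : 0 < s + 1 by lra.
by rewrite -(mulr_powRB1 x0 s0) addrK.
Qed.

(** With a single polynomial argument, the inner product is the value at a product, and polynomial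
    identities rewrite integrals directly. *)
Definition jacobi_int (R : realType) (a b : R) (p : {poly R}) : R :=
  \int[@lebesgue_measure R]_(x in `[-1, 1]) (jacobi_weight a b x * p.[x]).

Lemma jacobi_dotE (R : realType) (a b : R) (p q : {poly R}) :
  jacobi_dot a b (horner p) (horner q) = jacobi_int a b (p * q).
Proof. by apply: eq_Rintegral => x _; rewrite hornerM mulrA. Qed.

Section jacobi_int.
Variables (R : realType) (a b : R).
Hypotheses (a1 : -1 < a) (b1 : -1 < b).

Lemma jacobi_intD (p q : {poly R}) :
  jacobi_int a b (p + q) = jacobi_int a b p + jacobi_int a b q.
Proof.
rewrite -RintegralD//; try exact: integrable_jacobi_weight.
by apply: eq_Rintegral => x _; rewrite hornerD mulrDr.
Qed.

Lemma jacobi_intZ (k : R) (p : {poly R}) :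
  jacobi_int a b (k *: p) = k * jacobi_int a b p.
Proof.
rewrite -RintegralZl//; try exact: integrable_jacobi_weight.
by apply: eq_Rintegral => x _; rewrite hornerZ mulrCA.
Qed.

Lemma jacobi_intN (p : {poly R}) : jacobi_int a b (- p) = - jacobi_int a b p.
Proof. by rewrite -scaleN1r jacobi_intZ mulN1r. Qed.

Lemma jacobi_intB (p q : {poly R}) :
  jacobi_int a b (p - q) = jacobi_int a b p - jacobi_int a b q.
Proof. by rewrite jacobi_intD jacobi_intN. Qed.

Lemma jacobi_int0 : jacobi_int a b 0 = 0.
Proof. by rewrite -(scale0r 0) jacobi_intZ mul0r. Qed.

Lemma jacobi_int_sum (I : Type) (r : seq I) (P : pred I) (F : I -> {poly R}) :
  jacobi_int a b (\sum_(i <- r | P i) F i)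
  = \sum_(i <- r | P i) jacobi_int a b (F i).
Proof. exact: (big_morph _ jacobi_intD jacobi_int0). Qed.

Lemma jacobi_weight_shift (x : R) : -1 <= x <= 1 ->
  jacobi_weight (a + 1) (b + 1) x = jacobi_weight a b x * (1 - x ^+ 2).
Proof.
move=> /andP[x0 x1]; rewrite /jacobi_weight.
have -> : (1 - x) `^ (a + 1) = (1 - x) * (1 - x) `^ a.
  by apply: powR_addr1 => //; lra.
have -> : (1 + x) `^ (b + 1) = (1 + x) * (1 + x) `^ b.
  by apply: powR_addr1 => //; lra.
by ring.
Qed.

Lemma jacobi_int_shift (p : {poly R}) :
  jacobi_int (a + 1) (b + 1) p = jacobi_int a b ((1 - 'X^2) * p).
Proof.
apply: eq_Rintegral => x; rewrite inE/= in_itv/= => xI.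
by rewrite jacobi_weight_shift// !hornerE.
Qed.

Lemma jacobi_int_ibp (p : {poly R}) :
  jacobi_int a b (((b - a)%:P - (a + b + 2) *: 'X) * p + (1 - 'X^2) * p^`()) = 0.
Proof.
have a0 : 0 < a + 1 by rewrite -ltrBlDr sub0r.
have b0 : 0 < b + 1 by rewrite -ltrBlDr sub0r.
have -> : 0 = jacobi_weight (a + 1) (b + 1) 1 * p.[1]
              - jacobi_weight (a + 1) (b + 1) (-1) * p.[-1].
  by rewrite /jacobi_weight !subrr !powR0 ?mulr0 ?mul0r ?subrr// gt_eqF//; lra.
apply: (@FTC2_oo R _ (fun x => jacobi_weight (a + 1) (b + 1) x * p.[x])).
- by lra.
- exact: integrable_jacobi_weight.
- move=> x; rewrite in_itv/= => /andP[x0 x1].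
  apply: cvgM; last exact: continuous_horner.
  by apply: cvgM; [exact: continuous_onemD_powR|exact: continuous_onepD_powR].
- move=> x; rewrite in_itv/= => /andP[x0 x1].
  have dm := is_derive_onemD_powR (a + 1) x1.
  have dp := is_derive_onepD_powR (b + 1) x0.
  have := is_deriveM (is_deriveM dm dp) (is_derive_poly p x).
  rewrite /GRing.scale/= !addrK => /is_derive_eq; apply; rewrite !fctE.
  have -> : (1 - x) `^ (a + 1) = (1 - x) * (1 - x) `^ a.
    by apply: powR_addr1 => //; lra.
  have -> : (1 + x) `^ (b + 1) = (1 + x) * (1 + x) `^ b.
    by apply: powR_addr1 => //; lra.
  by rewrite !hornerE /jacobi_weight /=; ring.
- apply/continuous_within_itvP; first by lra.
  split.
  + move=> x; rewrite in_itv/= => /andP[x0 x1].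
    apply: cvgM; last exact: continuous_horner.
    by apply: cvgM; [exact: continuous_onemD_powR|exact: continuous_onepD_powR].
  + apply: cvgM; last by apply: cvg_at_right_filter; exact: continuous_horner.
    rewrite /jacobi_weight; apply: cvgM.
      by apply: cvg_at_right_filter; apply: continuous_onemD_powR; lra.
    by rewrite subrr powR0 ?gt_eqF//; exact: cvg_onepD_powR0.
  + apply: cvgM; last by apply: cvg_at_left_filter; exact: continuous_horner.
    rewrite /jacobi_weight; apply: cvgM; last first.
      by apply: cvg_at_left_filter; apply: continuous_onepD_powR; lra.
    by rewrite subrr powR0 ?gt_eqF//; exact: cvg_onemD_powR0.
Qed.

(** If the integral were 0, the integrand would vanish almost everywhere. The weight is nonzero on
    the open interval, so that interval would be covered by a null set and the roots of [p], against
    its measure 2. *)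
Lemma jacobi_int_sqr_gt0 (p : {poly R}) : p != 0 -> 0 < jacobi_int a b (p * p).
Proof.
move=> p0.
have f0 x : 0 <= jacobi_weight a b x * (p * p).[x].
  by rewrite hornerM -expr2 mulr_ge0 ?sqr_ge0// mulr_ge0 ?powR_ge0.
have intf := integrable_jacobi_weight (p * p) a1 b1.
rewrite lt_neqAle Rintegral_ge0// andbT eq_sym; apply/eqP => I0.
have /integrableP[mf _] := intf.
have int0 : (\int[@lebesgue_measure R]_(x in `[(-1)%R, 1%R])
    `|(jacobi_weight a b x * (p * p).[x])%:E| = 0)%E.
  transitivity (\int[@lebesgue_measure R]_(x in `[(-1)%R, 1%R])
      (jacobi_weight a b x * (p * p).[x])%:E)%E.
    by apply: eq_integral => x _ /=; rewrite ger0_norm.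
  by rewrite -(fineK (integrable_fin_num _ intf))//; congr (_%:E).
have /(ae_eq_integral_abs _ _ mf) [//|N [mN N0 sN]] := int0.
have negI : (@lebesgue_measure R).-negligible `]-1, 1[.
  have sub : `]-1, 1[ `<=` N `|` [set x | root p x].
    move=> x; rewrite /= in_itv/= => /andP[x0 x1].
    have [px|px] := boolP (root p x); [by right|left].
    apply: sN => /= h.
    have /h : `[-1, 1]%classic x by rewrite /= in_itv/= !ltW.
    move=> [] /eqP; rewrite hornerM !mulf_eq0 !powR_eq0.
    move: px; rewrite rootE => /negbTE ->; rewrite !orbF.
    by move=> /orP[] /andP[/eqP h' _]; lra.
  apply: (@negligibleS _ _ _ (@lebesgue_measure R) _ _ sub).
  apply: negligibleU; last exact: negligible_root.
  by exists N; split.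
have : @lebesgue_measure R `]-1, 1[%classic = 0%E.
  by apply: measure_negligible.
rewrite lebesgue_measure_itv/= lte_fin ifT; last by lra.
move=> /eqP; rewrite -EFinD eqe; apply/negP.
by rewrite gt_eqF//; lra.
Qed.

End jacobi_int.

(** * Orthogonality and the Jacobi differential equation *)

Lemma sum_graded_basis (F : fieldType) (Q : nat -> {poly F}) (n : nat)
    (p : {poly F}) : (forall k, size (Q k) = k.+1) -> (size p <= n)%N ->
  exists c : nat -> F, p = \sum_(i < n) c i *: Q i.
Proof.
move=> sQ; elim: n p => [|n IHn] p sp.
  by exists (fun=> 0); rewrite big_ord0; apply/eqP; rewrite -size_poly_leq0.
have lQ : (Q n)`_n != 0.
  by have := lead_coef_eq0 (Q n); rewrite lead_coefE sQ /= -size_poly_eq0 sQ => ->.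
(* Subtracting this multiple of [Q n] cancels the coefficient of degree n. *)
have [|c pE] := IHn (p - (p`_n / (Q n)`_n) *: Q n).
  apply/leq_sizeP => j; rewrite leq_eqVlt => /predU1P[<-|nj].
    by rewrite coefB coefZ divfK// subrr.
  have pj := leq_trans sp nj.
  have Qj : (size (Q n) <= j)%N by rewrite sQ.
  by rewrite coefB coefZ (nth_default _ pj) (nth_default _ Qj) mulr0 subr0.
exists (fun i => if i == n then p`_n / (Q n)`_n else c i).
rewrite big_ord_recr/= eqxx; apply/eqP; rewrite -subr_eq pE; apply/eqP.
by apply: eq_bigr => i _; rewrite ltn_eqF.
Qed.

Lemma jacobi_orth (R : realType) (a b : R) (Q : nat -> {poly R}) (k : nat)
    (q : {poly R}) : -1 < a -> -1 < b -> is_jacobi a b Q -> (size q <= k)%N ->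
  jacobi_int a b (Q k * q) = 0.
Proof.
move=> a1 b1 [sQ oQ _] /(sum_graded_basis sQ)[c ->].
rewrite mulr_sumr jacobi_int_sum// big1// => i _.
rewrite -scalerAr jacobi_intZ// -jacobi_dotE oQ ?mulr0//.
by move=> ki; have := ltn_ord i; rewrite -ki ltnn.
Qed.

(** Sturm-Liouville operator: on the open interval, [jacobi_weight a b] times its value is the
    derivative of [jacobi_weight (a + 1) (b + 1)] times p'. *)
Definition jacobi_op (R : realType) (a b : R) (p : {poly R}) : {poly R} :=
  (1 - 'X^2) * p^`()^`() + ((b - a)%:P - (a + b + 2) *: 'X) * p^`().

(** Shows that the operator is triangular on monomials: it does not raise the degree, and its
    diagonal entries are the eigenvalues. *)
Lemma coef_jacobi_op (R : realType) (a b : R) (p : {poly R}) (i : nat) :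
  (jacobi_op a b p)`_i = - (i%:R * (i%:R + a + b + 1)) * p`_i
     + (b - a) * i.+1%:R * p`_i.+1 + i.+1%:R * i.+2%:R * p`_i.+2.
Proof.
have coef_d (q : {poly R}) j : q^`()`_j = (j%:R + 1) * q`_j.+1.
  by rewrite coef_deriv natr1 mulr_natl.
rewrite /jacobi_op mulrBl mul1r mulrBl coefD !coefB coefXnM coefCM.
rewrite -scalerAl coefZ coefXM !coef_d -(natr1 i.+1) -(natr1 i).
case: i => [|[|i]] /=.
- by rewrite !mulr0n; ring.
- by rewrite mulr1n; ring.
- rewrite subSS subSS subn0 -(natr1 i.+1) -(natr1 i); ring.
Qed.

(** Integration by parts applied to p' q. The right side is symmetric in [p] and [q], and it also
    carries orthogonality over to derivatives for the shifted weight. *)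
Lemma jacobi_op_sym (R : realType) (a b : R) (p q : {poly R}) :
  -1 < a -> -1 < b ->
  jacobi_int a b (jacobi_op a b p * q)
  = - jacobi_int (a + 1) (b + 1) (p^`() * q^`()).
Proof.
move=> a1 b1; have := jacobi_int_ibp a1 b1 (p^`() * q).
rewrite jacobi_int_shift// => ibp; apply/eqP; rewrite -addr_eq0 -jacobi_intD//.
rewrite -[X in _ == X]ibp /jacobi_op derivM; apply/eqP; congr jacobi_int; ring.
Qed.

(** The defect [r] has degree below k because the diagonal entry is subtracted. Its inner product
    with [Q k] vanishes, and by symmetry so does that with [jacobi_op a b (Q k)], since
    [jacobi_op a b r] also has degree below k. So [r] is orthogonal to itself. *)
Lemma jacobi_opE (R : realType) (a b : R) (Q : nat -> {poly R}) (k : nat) :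
  -1 < a -> -1 < b -> is_jacobi a b Q ->
  jacobi_op a b (Q k) = - (k%:R * (k%:R + a + b + 1)) *: Q k.
Proof.
move=> a1 b1 hQ; have [sQ _ _] := hQ.
have size_op p : (size (jacobi_op a b p) <= size p)%N.
  apply/leq_sizeP => j pj; rewrite coef_jacobi_op !nth_default ?mulr0 ?addr0//.
    by rewrite (leq_trans pj)// leqW.
  by rewrite (leq_trans pj).
set l := - _; apply/eqP; rewrite -subr_eq0.
set r := _ - _.
have sr : (size r <= k)%N.
  apply/leq_sizeP => j; rewrite leq_eqVlt => /predU1P[<-|kj].
    rewrite /r coefB coefZ coef_jacobi_op !(nth_default 0 (_ : (_ <= _.+1)%N)).
      by rewrite !mulr0 !addr0 subrr.
    by rewrite sQ.
    by rewrite sQ.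
  by rewrite /r nth_default// (leq_trans (size_polyD _ _))// geq_max size_polyN
             (leq_trans (size_op _)) ?sQ// (leq_trans (size_scale_leq _ _)) ?sQ.
apply/negPn/negP => r0; have := jacobi_int_sqr_gt0 a1 b1 r0.
rewrite {1}/r mulrBl jacobi_intB// -scalerAl jacobi_intZ//.
rewrite (jacobi_orth a1 b1 hQ sr) mulr0 subr0.
rewrite jacobi_op_sym// [X in jacobi_int _ _ X]mulrC -jacobi_op_sym// mulrC.
by rewrite (jacobi_orth a1 b1 hQ) ?ltxx// (leq_trans (size_op _)).
Qed.

(** At an endpoint the factor 1 - X^2 removes the second-order term, and the equation ties the
    derivative to the value. *)
Lemma horner_deriv_jacobi_1 (R : realType) (a b : R) (Q : nat -> {poly R})
    (k : nat) : -1 < a -> -1 < b -> is_jacobi a b Q ->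
  2 * (a + 1) * (Q k)^`().[1] = k%:R * (k%:R + a + b + 1) * (Q k).[1].
Proof.
move=> a1 b1 /(jacobi_opE k a1 b1) /(congr1 (horner^~ 1)).
rewrite /jacobi_op !hornerE /= => h; apply: oppr_inj; rewrite -[RHS]mulNr -h.
by ring.
Qed.

Lemma horner_deriv_jacobi_N1 (R : realType) (a b : R) (Q : nat -> {poly R})
    (k : nat) : -1 < a -> -1 < b -> is_jacobi a b Q ->
  2 * (b + 1) * (Q k)^`().[-1] = - (k%:R * (k%:R + a + b + 1) * (Q k).[-1]).
Proof.
move=> a1 b1 /(jacobi_opE k a1 b1) /(congr1 (horner^~ (-1))).
rewrite /jacobi_op !hornerE /= => h; rewrite -mulNr -h.
by ring.
Qed.

(** * Derivatives, uniqueness and endpoint values of Jacobi polynomials *)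

Lemma pochhammerS (R : realType) (z : R) (k : nat) :
  pochhammer z k.+1 = z * pochhammer (z + 1) k.
Proof.
rewrite /pochhammer big_ord_recl addr0; congr (_ * _).
by apply: eq_bigr => i _; rewrite lift0 -natr1; ring.
Qed.

Lemma pochhammer_gt0 (R : realType) (z : R) (k : nat) :
  0 < z -> 0 < pochhammer z k.
Proof. by move=> z0; apply: prodr_gt0 => i _; rewrite ltr_wpDr. Qed.

(** Orthogonality of the derivatives follows from [jacobi_op_sym] and the eigenvalue equation; the
    scalar is the one that the normalization at 1 forces, by [horner_deriv_jacobi_1]. *)
Lemma is_jacobi_deriv (R : realType) (a b : R) (Q : nat -> {poly R}) :
  -1 < a -> -1 < b -> is_jacobi a b Q ->
  is_jacobi (a + 1) (b + 1)
    (fun k => (2 / (k.+1%:R + a + b + 1)) *: (Q k.+1)^`()).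
Proof.
move=> a1 b1 hQ; have [sQ oQ nQ] := hQ.
have s0 k : 0 < k.+1%:R + a + b + 1.
  by have : 0 <= k%:R :> R by []; rewrite -natr1; lra.
have a0 : 0 < a + 1 by lra.
split.
- move=> k; rewrite size_scale; last by rewrite mulf_neq0// ?invr_eq0 gt_eqF.
  apply/eqP; rewrite eqn_leq; apply/andP; split.
    by rewrite -ltnS (leq_trans (lt_size_deriv _)) ?sQ// -size_poly_eq0 sQ.
  rewrite ltnNge; apply/negP => /leq_sizeP /(_ _ (leqnn _)) /eqP.
  rewrite coef_deriv mulrn_eq0 /=.
  by have := lead_coef_eq0 (Q k.+1); rewrite lead_coefE sQ /= -size_poly_eq0 sQ => ->.
- move=> k l kl; rewrite jacobi_dotE -scalerAl -scalerAr !jacobi_intZ; try lra.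
  have := jacobi_op_sym (Q k.+1) (Q l.+1) a1 b1.
  rewrite (jacobi_opE _ a1 b1 hQ) -scalerAl jacobi_intZ// -(jacobi_dotE a b) oQ.
    by rewrite mulr0 => /esym/eqP; rewrite oppr_eq0 => /eqP ->; rewrite !mulr0.
  by move=> [].
- move=> k; have := horner_deriv_jacobi_1 k.+1 a1 b1 hQ.
  rewrite hornerZ nQ pochhammerS factS natrM => h.
  have k0 : k.+1%:R != 0 :> R by rewrite pnatr_eq0.
  have f0 : k`!%:R != 0 :> R by rewrite pnatr_eq0 -lt0n fact_gt0.
  have an0 : a + 1 != 0 by rewrite gt_eqF.
  have -> : (Q k.+1)^`().[1] = (2 * (a + 1) * (Q k.+1)^`().[1]) / (2 * (a + 1)).
    by field.
  by rewrite h; field; rewrite f0 an0 !nat1r k0 gt_eqF.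
Qed.

(** The combination [r] that cancels the leading terms has degree below k, so it is orthogonal to
    [Q k] and [Q' k], hence to itself. The nonzero value at 1 then fixes the scalar. *)
Lemma is_jacobi_uniq (R : realType) (a b : R) (Q Q' : nat -> {poly R})
    (k : nat) : -1 < a -> -1 < b -> is_jacobi a b Q -> is_jacobi a b Q' ->
  Q k = Q' k.
Proof.
move=> a1 b1 hQ hQ'; have [sQ _ nQ] := hQ; have [sQ' _ nQ'] := hQ'.
have lQ' : (Q' k)`_k != 0.
  by have := lead_coef_eq0 (Q' k); rewrite lead_coefE sQ' /= -size_poly_eq0 sQ' => ->.
pose c := (Q k)`_k / (Q' k)`_k; pose r := Q k - c *: Q' k.
have sr : (size r <= k)%N.
  apply/leq_sizeP => j; rewrite leq_eqVlt => /predU1P[<-|nj].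
    by rewrite coefB coefZ divfK// subrr.
  have Qj : (size (Q k) <= j)%N by rewrite sQ.
  have Q'j : (size (Q' k) <= j)%N by rewrite sQ'.
  by rewrite coefB coefZ (nth_default _ Qj) (nth_default _ Q'j) mulr0 subr0.
have r0 : r = 0.
  apply/eqP/negPn/negP => r0; have := jacobi_int_sqr_gt0 a1 b1 r0.
  rewrite {1}/r mulrBl jacobi_intB// -scalerAl jacobi_intZ//.
  by rewrite !(jacobi_orth a1 b1 _ sr)// mulr0 subrr ltxx.
have QE : Q k = c *: Q' k by apply/eqP; rewrite -subr_eq0; apply/eqP.
have Q'0 : (Q' k).[1] != 0.
  rewrite nQ' mulf_neq0 ?invr_eq0 ?pnatr_eq0 -?lt0n ?fact_gt0//.
  by rewrite gt_eqF// pochhammer_gt0//; lra.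
have := nQ k; rewrite -nQ' QE hornerZ -[RHS]mul1r => /(mulIf Q'0) ->.
by rewrite scale1r.
Qed.

(** Induction on k with the parameters varying: the derivative belongs to the family for a + 1 and b
    + 1, and the differential equation at -1 recovers the value from it. *)
Lemma horner_jacobi_N1 (R : realType) (a b : R) (Q : nat -> {poly R}) (k : nat) :
  -1 < a -> -1 < b -> is_jacobi a b Q ->
  (Q k).[-1] = (-1) ^+ k * pochhammer (b + 1) k / k`!%:R.
Proof.
elim: k a b Q => [|k IHk] a b Q a1 b1 hQ.
  have [sQ _ nQ] := hQ.
  have := nQ 0%N; rewrite (size1_polyC (eq_leq (sQ 0%N))) !hornerC => ->.
  by rewrite /pochhammer !big_ord0 expr0 !mul1r.
have a2 : -1 < a + 1 by lra.
have b2 : -1 < b + 1 by lra.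
have := IHk _ _ _ a2 b2 (is_jacobi_deriv a1 b1 hQ); rewrite hornerZ => h.
have := horner_deriv_jacobi_N1 k.+1 a1 b1 hQ.
have s0 : 0 < k.+1%:R + a + b + 1.
  by have : 0 <= k%:R :> R by []; rewrite -natr1; lra.
have {h} -> : (Q k.+1)^`().[-1] = (k.+1%:R + a + b + 1) / 2
    * ((-1) ^+ k * pochhammer (b + 1 + 1) k / k`!%:R).
  by rewrite -h; field; rewrite ?nat1r gt_eqF.
move=> h; rewrite pochhammerS factS natrM exprS.
have k0 : k.+1%:R != 0 :> R by rewrite pnatr_eq0.
have f0 : k`!%:R != 0 :> R by rewrite pnatr_eq0 -lt0n fact_gt0.
(* The eigenvalue is nonzero for positive degree, so it can be cancelled. *)
have c0 : k.+1%:R * (k.+1%:R + a + b + 1) != 0 by rewrite mulf_neq0// gt_eqF.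
apply: (mulfI c0); apply: oppr_inj; rewrite -h.
by field; rewrite ?nat1r k0 f0.
Qed.

(** * Legendre polynomials, primitives and division by a node *)

Lemma pochhammer1 (R : realType) (k : nat) : pochhammer 1 k = k`!%:R :> R.
Proof.
elim: k => [|k IHk]; first by rewrite /pochhammer big_ord0.
by rewrite /pochhammer big_ord_recr/= -/(pochhammer 1 k) IHk nat1r -natrM mulnC factS.
Qed.

Lemma is_jacobi_legendre (R : realType) (P : nat -> {poly R}) :
  is_legendre P -> is_jacobi 0 0 P.
Proof.
move=> [sP oP nP]; split => // [k l kl|k].
  rewrite -[RHS](oP k l kl); apply: eq_Rintegral => x _.
  by rewrite !powRr0 !mul1r.
by rewrite nP add0r pochhammer1 divff// pnatr_eq0 -lt0n fact_gt0.
Qed.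

Lemma Rintegral_deriv_horner (R : realType) (p : {poly R}) (a b : R) : a <= b ->
  \int[@lebesgue_measure R]_(x in `[a, b]) p^`().[x] = p.[b] - p.[a].
Proof.
rewrite le_eqVlt => /predU1P[->|ab].
  by rewrite set_itv1 Rintegral_set1 subrr.
apply: FTC2_oo => //.
- apply: continuous_compact_integrable; first exact: segment_compact.
  by apply: continuous_in_subspaceT => x _; exact: continuous_horner.
- by move=> x _; exact: continuous_horner.
- by move=> x _; exact: is_derive_poly.
- by apply: continuous_in_subspaceT => x _; exact: continuous_horner.
Qed.

Lemma jacobi_int00_deriv (R : realType) (p : {poly R}) :
  jacobi_int 0 0 p^`() = p.[1] - p.[-1].
Proof.
rewrite -Rintegral_deriv_horner; last by lra.
by apply: eq_Rintegral => x _; rewrite /jacobi_weight !powRr0 !mul1r.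
Qed.

(** At index 0 the quotient is a division by zero, so the constant coefficient is 0. *)
Definition primitive (F : fieldType) (p : {poly F}) : {poly F} :=
  \poly_(i < (size p).+1) (p`_i.-1 / i%:R).

Lemma deriv_primitive (F : numFieldType) (p : {poly F}) : (primitive p)^`() = p.
Proof.
apply/polyP => i; rewrite coef_deriv coef_poly ltnS -[LHS]mulr_natr.
case: ltnP => [_|pi]; first by rewrite divfK// pnatr_eq0.
by rewrite mul0r nth_default.
Qed.

Lemma deriv_eq0_polyC (F : numFieldType) (p : {poly F}) :
  p^`() = 0 -> p = (p`_0)%:P.
Proof.
move=> p0; apply/polyP => -[|i]; rewrite coefC//=.
have := congr1 (fun q : {poly F} => q`_i) p0.
by rewrite coef_deriv coef0 => /eqP; rewrite mulrn_eq0/= => /eqP.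
Qed.

(** The integrand of [Gfun] with its removable singularity filled in. *)
Definition div_node (F : fieldType) (p : {poly F}) (t : F) : {poly F} :=
  p %/ ('X - t%:P).

Lemma div_nodeK (F : fieldType) (p : {poly F}) (t : F) :
  root p t -> div_node p t * ('X - t%:P) = p.
Proof. by move=> pt; rewrite divpK// dvdp_XsubCl. Qed.

Lemma size_div_node (F : fieldType) (p : {poly F}) (t : F) :
  size (div_node p t) = (size p).-1.
Proof. by rewrite size_divp ?polyXsubC_eq0// size_XsubC subn1. Qed.

Lemma horner_div_node (F : fieldType) (p : {poly F}) (t x : F) :
  root p t -> x != t -> (div_node p t).[x] = p.[x] / (x - t).
Proof.
move=> pt xt; rewrite -{2}(div_nodeK pt) hornerM hornerXsubC mulfK//.
by rewrite subr_eq0.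
Qed.

Lemma horner_div_node_diag (F : fieldType) (p : {poly F}) (t : F) :
  root p t -> (div_node p t).[t] = p^`().[t].
Proof.
move=> pt; rewrite -{2}(div_nodeK pt) derivM derivXsubC mulr1.
by rewrite hornerD hornerM hornerXsubC subrr mulr0 add0r.
Qed.

(* With q = P_(m+1) / (X - t), both [(m+1) q] and [P_(m+1)'] have the leading
   coefficient of [P_(m+1)'], so their integrals against [P_m] agree; the latter
   is the integral of [(P_(m+1) P_m)'].  And [P_m] may be replaced by the constant
   [P_m(t)] since [q (P_m - P_m(t))] is a multiple of [P_(m+1)]. *)
Lemma legendre_div_node_int (R : realType) (P : nat -> {poly R}) (m : nat) (t : R) :
  is_legendre P -> root (P m.+1) t ->
  m.+1%:R * (P m).[t] * jacobi_int 0 0 (div_node (P m.+1) t) = 2.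
Proof.
move=> hP Pt; have hJ := is_jacobi_legendre hP.
have z1 : -1 < 0 :> R by rewrite ltrN10.
have [sP _ nP] := hP.
set q := div_node _ _.
have qP : q * ('X - t%:P) = P m.+1 by exact: div_nodeK.
have sq : size q = m.+1 by rewrite size_div_node sP.
have PN1 k : (P k).[-1] = (-1) ^+ k.
  rewrite (horner_jacobi_N1 _ z1 z1 hJ) add0r pochhammer1 mulfK//.
(* The other term of the product rule integrates to 0 by orthogonality; the product of the two
   polynomials is 1 at 1 and -1 at -1. *)
have I2 : jacobi_int 0 0 ((P m.+1)^`() * P m) = 2.
  have := jacobi_int00_deriv (P m.+1 * P m).
  rewrite derivM jacobi_intD// (jacobi_orth z1 z1 hJ); last first.
    rewrite (leq_trans (size_poly _ _))// sP//.
  have e : (-1) ^+ m * (-1) ^+ m = 1 :> R by rewrite -expr2 sqrr_sign.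
  by rewrite addr0 !hornerM !nP !PN1 exprS -[-1 * _ * _]mulrA e => ->; ring.
have Iq : jacobi_int 0 0 ((P m.+1)^`() * P m) = m.+1%:R * jacobi_int 0 0 (q * P m).
  rewrite -jacobi_intZ// scalerAl; apply/eqP; rewrite -subr_eq0 -jacobi_intB//.
  rewrite -mulrBl mulrC (jacobi_orth z1 z1 hJ)//.
  apply/leq_sizeP => j mj; rewrite coefB coef_deriv coefZ -qP.
  rewrite mulrBr coefB coefMX /= coefMC.
  move: mj; rewrite leq_eqVlt => /predU1P[<-|mj].
    by rewrite [q`_m.+1]nth_default ?sq// mul0r subr0 mulr_natl subrr.
  have qj : (size q <= j)%N by rewrite sq.
  rewrite (nth_default 0 qj) (nth_default 0 (leqW qj)).
  by rewrite mul0r subr0 mul0rn mulr0 subrr.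
have /factor_theorem[r rE] : root (P m - (P m).[t]%:P) t.
  by rewrite rootE !hornerE subrr.
have sr : (size r <= m)%N.
  have [->|r0] := eqVneq r 0; first by rewrite size_poly0.
  have : (size (r * ('X - t%:P))%R <= m.+1)%N.
    rewrite -rE (leq_trans (size_polyD _ _))// geq_max sP leqnn size_polyN.
    by rewrite (leq_trans (size_polyC_leq1 _)).
  by rewrite size_Mmonic ?monicXsubC// size_XsubC addn2.
have Ir : jacobi_int 0 0 (q * P m) = (P m).[t] * jacobi_int 0 0 q.
  rewrite -jacobi_intZ// -mul_polyC; apply/eqP; rewrite -subr_eq0 -jacobi_intB//.
  have -> : q * P m - (P m).[t]%:P * q = P m.+1 * r.
    by rewrite [q * P m]mulrC -mulrBl rE -qP; ring.
  by rewrite (jacobi_orth z1 z1 hJ)// (leq_trans sr).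
by rewrite -mulrA -Ir -Iq.
Qed.

(** * Interpolation at the Gauss nodes and expansion in the basis G *)

Section gauss_nodes.
Variables (R : realType) (P : nat -> {poly R}) (n : nat) (tau : nat -> R).
Hypotheses (hn : (1 <= n)%N) (hP : is_legendre P).
Hypothesis htau : ordered_zeros (P n) n tau.

Let root_node (j : 'I_n) : root (P n) (tau j.+1).
Proof. by have [_ _ h] := htau; apply/h; exists j.+1 => //; exact: ltn_ord. Qed.

Let node_inj : injective (fun j : 'I_n => tau j.+1).
Proof.
have [_ inc _] := htau.
move=> i j eij; apply/val_inj/eqP; case: ltngtP => // ij.
  by have := inc i.+1 j.+1 isT ij (ltn_ord j); rewrite eij ltxx.
by have := inc j.+1 i.+1 isT ij (ltn_ord i); rewrite eij ltxx.
Qed.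

Let poly_eq0_nodes (p : {poly R}) : (size p <= n)%N ->
  (forall j : 'I_n, p.[tau j.+1] = 0) -> p = 0.
Proof.
move=> sp p0; apply: (@roots_geq_poly_eq0 _ _ [seq tau j.+1 | j : 'I_n <- enum 'I_n]).
- by apply/allP => x /mapP[j _ ->]; rewrite rootE p0.
- by rewrite (map_inj_uniq node_inj) enum_uniq.
- by rewrite size_map size_enum_ord.
Qed.

(** The zeros are simple: otherwise the quotient, of degree n - 1, would vanish at all n nodes. *)
Let node_neq0 (j : 'I_n) : (P n)^`().[tau j.+1] != 0.
Proof.
have [sP _ _] := hP.
rewrite -horner_div_node_diag//; apply/negP => /eqP h.
have : div_node (P n) (tau j.+1) = 0.
  apply: poly_eq0_nodes; first by rewrite size_div_node sP.
  move=> i; have [->//|ij] := eqVneq i j.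
  rewrite horner_div_node// ?(inj_eq node_inj)//.
  by rewrite (eqP (root_node i)) mul0r.
move=> /(congr1 (fun p : {poly R} => size p)).
by rewrite size_div_node sP size_poly0/=; case: n hn.
Qed.

(** Dividing [div_node (P n) (tau j.+1)] by its value at the node gives the Lagrange fundamental
    polynomials. *)
Lemma lagrange_nodes (p : {poly R}) : (size p <= n)%N ->
  p = \sum_(j < n)
        (p.[tau j.+1] / (P n)^`().[tau j.+1]) *: div_node (P n) (tau j.+1).
Proof.
move=> sp; have [sP _ _] := hP.
apply/eqP; rewrite -subr_eq0; apply/eqP/poly_eq0_nodes.
  rewrite (leq_trans (size_polyD _ _))// geq_max sp size_polyN.
  apply: (leq_trans (size_sum _ _ _)); apply/bigmax_leqP => j _.
  by rewrite (leq_trans (size_scale_leq _ _))// size_div_node sP.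
move=> i; rewrite hornerD hornerN horner_sum (bigD1 i)//= hornerZ.
rewrite horner_div_node_diag// divfK// big1 ?addr0 ?subrr// => j ji.
rewrite hornerZ horner_div_node// ?(inj_eq node_inj) 1?eq_sym//.
by rewrite (eqP (root_node i)) mul0r mulr0.
Qed.

Definition Gpoly (i : nat) : {poly R} :=
  if i is 0 then (1 / 2)%:P
  else let q := div_node (P n) (tau i) in
    (n%:R * (P n.-1).[tau i] / 2) *: (primitive q - (primitive q).[-1]%:P)
    - (1 / 2)%:P.

(** The two integrands can differ only at the node, a null set that is removed from both
    integrals. *)
Lemma Gfun_Gpoly (i : nat) (t : R) : (i <= n)%N -> -1 <= t ->
  Gfun P n tau i t = (Gpoly i).[t].
Proof.
case: i => [|i] in_ t1; rewrite /= ?hornerC//.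
have pt : root (P n) (tau i.+1) := root_node (Ordinal in_).
rewrite hornerD hornerN hornerC hornerZ hornerD hornerN hornerC.
congr (_ * _ - _); rewrite /oriented_integral t1.
rewrite -Rintegral_deriv_horner// deriv_primitive.
pose D : set R := `[-1, t]%classic.
have eqD : {in D `\ tau i.+1,
    (fun x => (P n).[x] / (x - tau i.+1)) =1 horner (div_node (P n) (tau i.+1))}.
  by move=> x; rewrite inE => -[_ /eqP xt]; rewrite horner_div_node.
have mq : measurable_fun (D `\ tau i.+1) (horner (div_node (P n) (tau i.+1))).
  apply/measurable_funTS; apply: continuous_measurable_fun.
  exact: continuous_horner.
rewrite /Rintegral -/D; congr fine.
rewrite -(@integral_setD1 _ _ (tau i.+1)); last 2 first.
- by apply: measurableD; [exact: measurable_itv|exact: measurable_set1].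
- apply/measurable_EFinP; apply: eq_measurable_fun mq => x xD.
  by rewrite eqD.
rewrite -[RHS](@integral_setD1 _ _ (tau i.+1)); last 2 first.
- by apply: measurableD; [exact: measurable_itv|exact: measurable_set1].
- exact/measurable_EFinP.
by apply: eq_integral => x xD; rewrite eqD.
Qed.

Lemma deriv_Gpoly (j : 'I_n) : (Gpoly j.+1)^`() =
  (n%:R * (P n.-1).[tau j.+1] / 2) *: div_node (P n) (tau j.+1).
Proof.
by rewrite /= derivD derivN derivC subr0 derivZ derivB derivC subr0 deriv_primitive.
Qed.

Lemma Gpoly_N1 (j : 'I_n) : (Gpoly j.+1).[-1] = - (1 / 2).
Proof. by rewrite /= !hornerE subrr mulr0 sub0r. Qed.

Lemma legendre_node (j : 'I_n) :
  n%:R * (P n.-1).[tau j.+1] * jacobi_int 0 0 (div_node (P n) (tau j.+1)) = 2.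
Proof.
have := @legendre_div_node_int R P n.-1 (tau j.+1) hP.
by rewrite prednK// => /(_ (root_node j)).
Qed.

Lemma Gpoly_1 (j : 'I_n) : (Gpoly j.+1).[1] = 1 / 2.
Proof.
have := jacobi_int00_deriv (Gpoly j.+1); rewrite Gpoly_N1 deriv_Gpoly.
rewrite jacobi_intZ ?ltrN10// mulrAC legendre_node.
lra.
Qed.

(** The right side is the Lagrange fundamental polynomial of the node, so interpolating p' amounts
    to expanding it in the derivatives of [Gpoly]. *)
Lemma gauss_weight_deriv_Gpoly (j : 'I_n) :
  gauss_weight P n tau j.+1 *: (Gpoly j.+1)^`()
  = (P n)^`().[tau j.+1]^-1 *: div_node (P n) (tau j.+1).
Proof.
rewrite deriv_Gpoly scalerA /gauss_weight; congr (_ *: _).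
have := legendre_node j; set u := n%:R * _.
(* [u] is nonzero, being a factor of the product 2 in [legendre_node]. *)
have [->|u0 _] := eqVneq u 0; first by rewrite mul0r; lra.
by have := node_neq0 j => d0; field; rewrite u0 d0.
Qed.

Lemma Gpoly_expansion (p : {poly R}) : (size p <= n.+1)%N ->
  p = (p.[1] + p.[-1]) *: Gpoly 0
      + \sum_(j < n) (gauss_weight P n tau j.+1 * p^`().[tau j.+1]) *: Gpoly j.+1.
Proof.
move=> sp; set rhs := _ + _.
have sp' : (size p^`() <= n)%N.
  have [->|p0] := eqVneq p 0; first by rewrite deriv0 size_poly0.
  by rewrite -ltnS (leq_trans (lt_size_deriv p0)).
have D0 : (p - rhs)^`() = 0.
  have deriv_sum (F : 'I_n -> {poly R}) :
      (\sum_(j < n) F j)^`() = \sum_(j < n) (F j)^`() by exact: linear_sum.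
  rewrite derivB /rhs derivD derivZ derivC scaler0 add0r deriv_sum.
  rewrite {1}(lagrange_nodes sp'); apply/eqP; rewrite subr_eq0; apply/eqP.
  apply: eq_bigr => j _; rewrite derivZ [gauss_weight _ _ _ _ * _]mulrC -[RHS]scalerA.
  by rewrite gauss_weight_deriv_Gpoly scalerA.
have [d DE] : exists d, p - rhs = d%:P.
  by exists (p - rhs)`_0; exact: deriv_eq0_polyC.
(* The values at 1 and -1 of each [Gpoly j.+1] cancel, while those of [Gpoly 0] add up to 1; hence 2
   d = 0. *)
have D1 : (p - rhs).[1] + (p - rhs).[-1] = 0.
  rewrite !hornerD !hornerN !hornerD !hornerZ !hornerC !horner_sum.
  pose w (j : 'I_n) := gauss_weight P n tau j.+1 * p^`().[tau j.+1].
  have -> : \sum_(j < n) (w j *: Gpoly j.+1).[1]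
            = - \sum_(j < n) (w j *: Gpoly j.+1).[-1].
    rewrite -sumrN; apply: eq_bigr => j _.
    by rewrite !hornerZ Gpoly_1 Gpoly_N1 mulrN opprK.
  set s := \sum_(_ < _) _; lra.
apply/eqP; rewrite -subr_eq0 DE polyC_eq0.
by move: D1; rewrite DE !hornerC => D1; apply/eqP; lra.
Qed.

End gauss_nodes.

(** * The coefficients of the dual polynomials *)

Lemma deriv_jacobi (R : realType) (J : R -> R -> nat -> {poly R}) (a b : R)
    (i : nat) : -1 < a -> -1 < b ->
  (forall a b : R, -1 < a -> -1 < b -> is_jacobi a b (J a b)) ->
  (J a b i)^`() =
    ((i%:R + (a + b + 1)) / 2) *: pred_index (J (a + 1) (b + 1)) i.
Proof.
move=> a1 b1 hJ; have [sJ _ _] := hJ _ _ a1 b1.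
case: i => [|i] /=.
  by rewrite scaler0 (size1_polyC (eq_leq (sJ 0%N))) derivC.
have a2 : -1 < a + 1 by lra.
have b2 : -1 < b + 1 by lra.
(* The rescaled derivatives form a Jacobi family for a + 1 and b + 1, so uniqueness identifies them
   with the given one. *)
have hJ' := is_jacobi_deriv a1 b1 (hJ _ _ a1 b1).
rewrite (is_jacobi_uniq i a2 b2 (hJ _ _ a2 b2) hJ').
have s0 : i.+1%:R + a + b + 1 != 0.
  rewrite gt_eqF//; have : 0 <= i%:R :> R by [].
  by rewrite -natr1; lra.
rewrite scalerA (_ : _ * _ = 1) ?scale1r// !addrA.
by field; rewrite nat1r.
Qed.

Theorem theorem3p3 (R : realType) (n : nat) (alpha beta : R)
    (P : nat -> {poly R}) (J : R -> R -> nat -> {poly R})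
    (tau : nat -> R) (dG : nat -> {poly R})
    (hn : (1 <= n)%N) (halpha : -1 < alpha) (hbeta : -1 < beta)
    (hP : is_legendre P)
    (hJ : forall a b : R, -1 < a -> -1 < b -> is_jacobi a b (J a b))
    (htau : ordered_zeros (P n) n tau)
    (hdG : is_dual_basis alpha beta n (Gfun P n tau) dG) :
  forall j, (j <= n)%N ->
    dG j = \sum_(i < n.+1)
             ((jacobi_sqnorm alpha beta (J alpha beta) i)^-1
                * dual_coef alpha beta P J n tau j i) *: J alpha beta i.
Proof.
move=> j jn; have [sdG odG] := hdG.
have hJa := hJ _ _ halpha hbeta; have [sJ oJ nJ] := hJa.
have [c dGE] := sum_graded_basis sJ (sdG j jn).
rewrite {1}dGE; apply: eq_bigr => i _; congr (_ *: _).
have size_J : (size (J alpha beta i) <= n.+1)%N by rewrite sJ ltnS -ltnS.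
have hi : jacobi_sqnorm alpha beta (J alpha beta) i != 0.
  rewrite /jacobi_sqnorm jacobi_dotE gt_eqF// jacobi_int_sqr_gt0//.
  by rewrite -size_poly_eq0 sJ.
(* Pairing with the i-th Jacobi polynomial isolates [c i]; what remains is to compute this
   pairing. *)
have coef_dot : jacobi_int alpha beta (J alpha beta i * dG j)
    = jacobi_sqnorm alpha beta (J alpha beta) i * c i.
  rewrite dGE mulr_sumr jacobi_int_sum// (bigD1 i)//= big1 ?addr0.
    by rewrite -scalerAr jacobi_intZ// -jacobi_dotE mulrC.
  move=> k ki; rewrite -scalerAr jacobi_intZ// -jacobi_dotE oJ ?mulr0//.
  by move=> ik; move/eqP: ki; apply; exact/val_inj/esym.
have dual_Gpoly m : (m <= n)%N ->
    jacobi_int alpha beta (Gpoly P n tau m * dG j) = (m == j)%:R.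
  move=> mn; rewrite -odG// -jacobi_dotE; apply: eq_Rintegral => x.
  by rewrite inE/= in_itv/= => /andP[x1 _]; rewrite (Gfun_Gpoly htau).
suff <- : jacobi_int alpha beta (J alpha beta i * dG j)
    = dual_coef alpha beta P J n tau j i.
  by rewrite coef_dot mulKf.
(* Expand the Jacobi polynomial in the basis G: duality retains only the coefficient of index j. *)
rewrite (Gpoly_expansion hn hP htau size_J) mulrDl jacobi_intD// -scalerAl.
rewrite jacobi_intZ// dual_Gpoly// mulr_suml jacobi_int_sum//.
under eq_bigr => m _.
  rewrite -scalerAl jacobi_intZ// dual_Gpoly//.
  over.
(* For j = 0 that coefficient is the sum of the endpoint values; otherwise it is the Gauss weight
   times the derivative at the node. *)
case: j jn {sdG odG c dGE coef_dot dual_Gpoly} => [_|j jn] /=.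
  rewrite big1 ?addr0 ?mulr1; last by move=> m _; rewrite mulr0.
  rewrite nJ (horner_jacobi_N1 _ halpha hbeta hJa) -mulrDl mulrC.
  by [].
rewrite mulr0 add0r (bigD1 (Ordinal jn))//= eqxx mulr1 big1 ?addr0; last first.
  move=> m /negbTE mj; rewrite eqSS.
  have -> : (m == j :> nat) = (m == Ordinal jn) by [].
  by rewrite mj mulr0.
by rewrite (deriv_jacobi _ halpha hbeta hJ) hornerZ [LHS]mulrA.
Qed.
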